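(* Let $\mathbf G=\{G_1,G_2,\ldots\}$ be a countable family of countable sets satisfying conditions (g$_1$) and (g$_2$) of the context. Then the strong topology $\mathfrak T_{\mathrm b}(\mathcal V_{\mathcal S},\mathcal V'_{\mathcal S})$ on $\mathcal V_{\mathcal S}$ is generated by the norm $$\|w\|_{\mathcal S}:=\sup_kp_k(w),\qquad p_k(w):=\sum_{g\in G_k}|w(g)| .$$
   Context: $\mathbf G=\{G_1,G_2,\ldots\}$ is a (finite or infinite) countable family of countable sets, which may have non-empty intersections. $G$ is the simple graph whose vertex set is $\bigcup_kG_k$, two distinct vertices being joined by an edge if and only if they belong to the same set $G_k$ for some $k$. $\mathcal W$ is the linear space of real-valued functions on the vertex set of $G$. $\mathcal S^\emptyset$ is the set of all non-negative $w\in\mathcal W$ with $\sum_{g\in G_k}w(g)\le1$ for every $k$. $\mathcal V_{\mathcal S}$ is the normal cover of the linear span of $\mathcal S^\emptyset$, i.e. the set of all $\tilde w\in\mathcal W$ such that, for some $w$ in this linear span, $|\tilde w(g)|\le|w(g)|$ for all $g$. A path $g_0\to g_1\to\dots\to g_l$ in $G$ is a sequence of vertices in which consecutive vertices are joined by an edge. A path is a cycle if $g_0=g_l$ and the number of distinct vertices $g_j$ is at least $3$. A path is admissible if no three adjacent (i.e. consecutive) vertices of it belong to the same set $G_k$; for a cycle $g_0\to\dots\to g_l=g_0$ adjacency is understood cyclically (so the triple $g_{l-1},g_0,g_1$ is included), and its number of vertices is $l$. Conditions: (g$_1$) every vertex of $G$ belongs to at most two of the sets $G_k$; (g$_2$)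 every admissible cycle in $G$ has an even number of vertices. For a linear subspace $\mathcal V\subseteq\mathcal W$ containing all finitely supported functions, $\mathcal V'$ is the space of all $w'\in\mathcal W$ with $\sum_g|w(g)w'(g)|<\infty$ for all $w\in\mathcal V$, $\langle w,w'\rangle:=\sum_gw(g)w'(g)$, and $\mathfrak T_{\mathrm w}(\mathcal V',\mathcal V)$ is the weak topology on $\mathcal V'$ defined by the functionals $\langle w,\cdot\rangle$, $w\in\mathcal V$. The strong topology $\mathfrak T_{\mathrm b}(\mathcal V,\mathcal V')$ on $\mathcal V$ is generated by the seminorms $w\mapsto\sup_{w'\in\Omega'}|\langle w,w'\rangle|$, where $\Omega'$ runs over all $\mathfrak T_{\mathrm w}(\mathcal V',\mathcal V)$-bounded subsets of $\mathcal V'$. *)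

(* Defs.v *)
From HB Require Import structures.
From mathcomp Require Import all_boot all_order all_algebra.
From mathcomp Require Import all_classical all_reals all_analysis.

Set Implicit Arguments.
Unset Strict Implicit.
Unset Printing Implicit Defensive.

Import Order.TTheory GRing.Theory Num.Theory.
Import numFieldNormedType.Exports.

Local Open Scope classical_set_scope.
Local Open Scope ring_scope.

Section seminorm_topology.
Context {R : realType} {E : lmodType R}.
Implicit Types (X : set E) (P : set (E -> R)).

Definition seminorm_ball X (F : set (E -> R)) (x : E) (e : R) : set (set_type X) :=
  [set y | forall p, F p -> p (val y - x) < e].

(* The subspace X of E with the topology generated by the restrictions to X
   of the seminorms in P. *)
Definition seminorm_space X P : Type := set_type X.

Definition seminorm_open X P : set (set (seminorm_space X P)) :=
  [set U | forall x, U x -> exists F : set (E -> R),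
    [/\ finite_set F, F `<=` P &
        exists2 e : R, 0 < e & seminorm_ball F (val x) e `<=` U]].

HB.instance Definition _ X P := Choice.copy (seminorm_space X P) (set_type X).

Lemma seminorm_openT X P : seminorm_open (setT : set (seminorm_space X P)).
Proof. by move=> x _; exists set0; split => //; exists 1. Qed.

Lemma seminorm_openI X P (A B : set (seminorm_space X P)) :
  seminorm_open A -> seminorm_open B -> seminorm_open (A `&` B).
Proof.
move=> oA oB x [/oA[F [finF FP [e e0 eA]]] /oB[H [finH HP [d d0 dB]]]].
exists (F `|` H); split; [by rewrite finite_setU|by rewrite subUset|].
exists (Num.min e d); first by rewrite lt_min e0.
move=> y xy; split.
- by apply: eA => p Fp; have := xy p (or_introl Fp); rewrite lt_min => /andP[].
- by apply: dB => p Hp; have := xy p (or_intror Hp); rewrite lt_min => /andP[].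
Qed.

Lemma seminorm_open_bigU X P (I : Type) (f : I -> set (seminorm_space X P)) :
  (forall i, seminorm_open (f i)) -> seminorm_open (\bigcup_i f i).
Proof.
move=> of_ x [i _ /(of_ i)[F [finF FP [e e0 eU]]]].
by exists F; split => //; exists e => // y /eU; exists i.
Qed.

HB.instance Definition _ X P := @isOpenTopological.Build (seminorm_space X P)
  (@seminorm_open X P) (@seminorm_openT X P) (@seminorm_openI X P)
  (@seminorm_open_bigU X P).

(* Boundedness in a topological vector space: being absorbed by every
   neighbourhood of zero. *)
Definition tvs_bounded X P : set (set E) :=
  [set Omega | Omega `<=` X /\
    forall U : set (seminorm_space X P), open U -> (val @` U) 0 ->
      exists2 r : R, 0 < r &
        forall s : R, r <= `|s| -> Omega `<=` *:%R s @` (val @` U)].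

Definition linear_span (S : set E) : set E :=
  [set w | exists n (a : 'I_n -> R) (s : 'I_n -> E),
    (forall i, S (s i)) /\ w = \sum_i a i *: s i].

Definition is_norm_on X (N : E -> R) : Prop :=
  [/\ forall u v, X u -> X v -> N (u + v) <= N u + N v,
      forall a u, X u -> N (a *: u) = `|a| * N u &
      forall u, X u -> N u = 0 -> u = 0].

End seminorm_topology.

Section duality.
Context {R : realType} {T : choiceType}.
Implicit Types (V : set (T -> R)).

(* \esum is a supremum of finite partial sums, hence the splitting into positive
   and negative parts; the value is the sum of the series whenever
   \sum_g |w g * w' g| < +oo. *)
Definition pairing (w w' : T -> R) : R :=
  let f := fun g => (w g * w' g)%:E in
  fine (\esum_(g in [set: T]) f^\+ g - \esum_(g in [set: T]) f^\- g)%E.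

Definition dual V : set (T -> R) :=
  [set w' | forall w, V w -> summable [set: T] (fun g => (w g * w' g)%:E)].

Definition weak_seminorms V : set ((T -> R) -> R) :=
  [set (fun w' => `|pairing w w'|) | w in V].

Definition weakly_bounded V : set (set (T -> R)) :=
  tvs_bounded (dual V) (weak_seminorms V).

Definition strong_seminorms V : set ((T -> R) -> R) :=
  [set (fun w => sup [set `|pairing w w'| | w' in Omega])
     | Omega in weakly_bounded V].

Definition strong_space V : topologicalType :=
  seminorm_space V (strong_seminorms V).

Definition normal_cover V : set (T -> R) :=
  [set u | exists2 w, V w & forall g, `|u g| <= `|w g|].

End duality.

(* The vertex set is the whole type T: the families GG below are meant to cover T. *)
Section families.
Context {T : choiceType}.
Implicit Types (GG : set (set T)) (c : seq T).

(* All points of D belong to one and the same member of the family. *)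
Definition same_set GG (D : set T) : Prop := exists2 A, GG A & D `<=` A.

Definition edge GG : rel T :=
  fun x y => (x != y) && `[< same_set GG [set x; y] >].

Definition admissible GG c : Prop :=
  forall x y z, infix [:: x; y; z] c -> ~ same_set GG [set x; y; z].

(* The cycle g_0 -> ... -> g_l = g_0 is represented by c = [:: g_0; ...; g_(l-1)],
   so that its number of vertices is size c; c ++ take 2 c is
   [:: g_0; ...; g_(l-1); g_0; g_1], whose consecutive triples are the cyclic ones. *)
Definition admissible_cycle GG c : Prop :=
  [/\ cycle (edge GG) c, (3 <= size (undup c))%N & admissible GG (c ++ take 2 c)].

Definition cond_g1 GG : Prop :=
  forall g : T, ([set A | GG A /\ A g] #<= `I_2)%card.

Definition cond_g2 GG : Prop :=
  forall c, admissible_cycle GG c -> ~~ odd (size c).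

Context {R : realType}.

Definition Sempty GG : set (T -> R) :=
  [set w | (forall g, 0 <= w g) /\
           forall A, GG A -> (\esum_(g in A) (w g)%:E <= 1)%E].

Definition VS GG : set (T -> R) := normal_cover (linear_span (Sempty GG)).

Definition normS GG (w : T -> R) : \bar R :=
  ereal_sup [set \esum_(g in A) `|w g|%:E | A in GG].

End families.

(* Main.v *)
Require Import Defs.
From mathcomp Require Import all_boot all_order all_algebra finmap ring lra.
From mathcomp Require Import all_classical all_reals all_analysis.

Import Order.TTheory GRing.Theory Num.Theory.
Import numFieldNormedType.Exports.

Local Open Scope classical_set_scope.
Local Open Scope ring_scope.

(** The space [VS GG] consists of the functions [w] with [normS GG w < +oo]: a
  finite combination of elements of [Sempty GG] has finite norm, the normal
  cover preserves this, and conversely [`|w| / C] lies in [Sempty GG] as soon as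
  the norm of [w] is at most [C > 0] ([VSP]). It remains to compare the two
  families of seminorms on this space.

  The norm dominates every strong seminorm by the uniform boundedness principle.
  The space is complete ([VS_complete]), because each coordinate is bounded by
  the norm and sums over finite subsets of a block (a member of [GG]) pass to
  pointwise limits. The principle is used twice. For a fixed [w'] in the dual,
  the partial sums of [\sum_g w g * w' g] over finite sets of vertices are
  continuous functionals of [w], pointwise bounded since the series converges
  absolutely; hence they are uniformly bounded, and pairing with [w'] is
  continuous ([dual_pairing_bounded]). A weakly bounded set of the dual is
  therefore a pointwise bounded set of continuous functionals, hence uniformly
  bounded ([strong_seminorm_le]).

  Conversely, the norm is dominated by a single strong seminorm. The functions
  [w'] bounded in absolute value by the indicator of some block form a weakly
  bounded set, for they satisfy [`|pairing w w'| <= packing_norm GG w]; choosing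
  the signs of [w'] on a block to be those of [w] recovers the sum of [`|w|]
  over that block ([packing_norm_le_strong]). *)

Set Implicit Arguments.
Unset Strict Implicit.
Unset Printing Implicit Defensive.

(** * Topologies generated by seminorms on a subspace *)

Lemma finite_set_le_bound {R : realType} {I : Type} (F : set I) (c : I -> R) :
  finite_set F -> exists2 K, 0 < K & forall i, F i -> c i <= K.
Proof.
move=> /(finite_image c)/finite_seqP[s cF].
exists (\sum_(x <- s) `|x| + 1) => [|i Fi].
  by rewrite ltr_wpDl// sumr_ge0.
have : c i \in s by have : [set` s] (c i) by rewrite -cF; exists i.
move=> /(perm_to_rem) /(perm_big _) -> /=; rewrite big_cons.
have := ler_norm (c i).
have : 0 <= \sum_(j <- rem (c i) s) `|j| by rewrite sumr_ge0.
lra.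
Qed.

Section seminorms.
Context {R : realType} {E : lmodType R}.
Implicit Types (X Omega : set E) (P Q : set (E -> R)) (p N : E -> R).

Definition linear_subspace X : Prop :=
  X 0 /\ forall (a : R) u v, X u -> X v -> X (a *: u + v).

Definition seminorm_on X p : Prop :=
  (forall u v, X u -> X v -> p (u + v) <= p u + p v) /\
  (forall a u, X u -> p (a *: u) = `|a| * p u).

Definition linear_on X p : Prop :=
  (forall u v, X u -> X v -> p (u + v) = p u + p v) /\
  (forall a u, X u -> p (a *: u) = a * p u).

Definition bounded_linear_on X N (f : E -> R) : Prop :=
  linear_on X f /\ exists C : R, forall u, X u -> `|f u| <= C * N u.

(** Completeness in the form used below: a nested sequence of closed balls whose
  radii tend to zero has a common point. *)
Definition nested_complete X N : Prop :=
  forall (x : nat -> E) (r : nat -> R), (forall n, X (x n)) ->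
    (forall m n, (n <= m)%N -> N (x m - x n) <= r n) -> r @ \oo --> (0 : R) ->
  exists2 y, X y & forall n, N (y - x n) <= r n.

Section subspace.
Context {X : set E} (linX : linear_subspace X).

Lemma subspaceD u v : X u -> X v -> X (u + v).
Proof. by move=> Xu Xv; have := linX.2 1 u v Xu Xv; rewrite scale1r. Qed.

Lemma subspaceZ a u : X u -> X (a *: u).
Proof. by move=> Xu; have := linX.2 a u 0 Xu linX.1; rewrite addr0. Qed.

Lemma subspaceB u v : X u -> X v -> X (u - v).
Proof.
by move=> Xu Xv; apply: subspaceD => //; rewrite -scaleN1r; exact: subspaceZ.
Qed.

Lemma seminorm0 p : seminorm_on X p -> p 0 = 0.
Proof. by case=> _ /(_ 0 0 linX.1); rewrite scale0r normr0 mul0r. Qed.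

Lemma seminorm_ge0 p u : seminorm_on X p -> X u -> 0 <= p u.
Proof.
move=> sp Xu; have := sp.1 u (- u) Xu; rewrite subrr (seminorm0 sp) -scaleN1r.
rewrite sp.2// normrN1 mul1r => /(_ (subspaceZ _ Xu)); lra.
Qed.

Lemma linear_seminorm f : linear_on X f -> seminorm_on X (fun u => `|f u|).
Proof.
move=> [fD fZ]; split=> [u v Xu Xv|a u Xu].
- by rewrite fD// ler_normD.
- by rewrite fZ// normrM.
Qed.

(** A neighbourhood involves only finitely many seminorms, so domination of each
  [p] by a multiple of one [q] suffices: the radius is divided by the largest of
  the finitely many constants. *)
Lemma seminorm_open_le P Q :
    (forall p, P p -> exists2 q, Q q &
      exists C : R, forall u, X u -> p u <= C * q u) ->
    (forall q u, Q q -> X u -> 0 <= q u) ->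
  forall U : set (set_type X),
    @seminorm_open R E X P U -> @seminorm_open R E X Q U.
Proof.
move=> PQ Q0 U oU x /oU[F [finF FP [e e0 eU]]].
have /choice[q qP] : forall p, exists q, F p ->
    Q q /\ exists C : R, forall u, X u -> p u <= C * q u.
  move=> p; have [Fp|nFp] := pselect (F p); last by exists p.
  by have [q Qq CP] := PQ p (FP p Fp); exists q.
have /choice[C CP] : forall p, exists C : R, F p ->
    forall u, X u -> p u <= C * q p u.
  move=> p; have [Fp|nFp] := pselect (F p); last by exists 0.
  by have [_ [C CP]] := qP p Fp; exists C.
have [K K0 CK] := finite_set_le_bound C finF.
exists (q @` F); split.
- exact: finite_image.
- by move=> _ [p Fp <-]; exact: (qP p Fp).1.
- exists (e / K); first exact: divr_gt0.
  move=> y xy; apply: eU => p Fp.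
  have Xyx : X (val y - val x) by apply: subspaceB; exact: set_valP.
  have [Qq _] := qP p Fp.
  apply: le_lt_trans (CP p Fp _ Xyx) _.
  have := xy (q p) (ex_intro2 _ _ p Fp erefl); rewrite ltr_pdivlMr// mulrC.
  by apply: le_lt_trans; apply: ler_wpM2r; [exact: Q0|exact: CK].
Qed.

Lemma seminorm_ball_open p :
  seminorm_on X p ->
  forall P, P p -> @seminorm_open R E X P [set y | p (val y) < 1].
Proof.
move=> sp P Pp x /= px; exists [set p]; split => //.
- by move=> _ ->.
- exists (1 - p (val x)); first by rewrite subr_gt0.
  move=> y /(_ p erefl) yx /=.
  have := sp.1 (val y - val x) (val x); rewrite subrK.
  move=> /(_ (subspaceB (set_valP y) (set_valP x)) (set_valP x)).
  lra.
Qed.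

(** Absorption by the open set where [p < 1] gives the bound on [p]; conversely
  every neighbourhood of zero contains a finite intersection of balls, and
  finitely many bounds have a common upper bound. *)
Lemma tvs_boundedP P Omega : (forall p, P p -> seminorm_on X p) ->
  @tvs_bounded R E X P Omega <->
  Omega `<=` X /\ forall p, P p -> exists M : R, forall u, Omega u -> p u <= M.
Proof.
move=> sP; split=> [[OX bO]|[OX bO]]; split=> //.
  move=> p Pp; have sp := sP p Pp.
  pose U : set (seminorm_space X P) := [set y | p (val y) < 1].
  have U0 : (val @` U) 0.
    exists (SigSub (mem_set linX.1)) => //.
    by rewrite /U /= (seminorm0 sp).
  have [r r0 /(_ r)] := bO U (seminorm_ball_open sp Pp) U0.
  rewrite gtr0_norm// => /(_ (lexx r)) OU; exists r => u /OU[_ [y py <-] <-].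
  rewrite sp.2; last exact: set_valP.
  by rewrite gtr0_norm// -[leRHS]mulr1 ler_pM2l// ltW.
move=> U oU [x Ux x0]; have [F [finF FP [e e0 eU]]] := oU x Ux.
have /choice[M MP] : forall p, exists M : R, F p ->
    forall u, Omega u -> p u <= M.
  move=> p; have [Fp|nFp] := pselect (F p); last by exists 0.
  by have [M MP] := bO p (FP p Fp); exists M.
have [K K0 MK] := finite_set_le_bound M finF.
exists (K / e + 1); first by rewrite addr_gt0 ?divr_gt0.
move=> s Ks u Ou.
have s0 : 0 < `|s| by apply: lt_le_trans Ks; rewrite addr_gt0 ?divr_gt0.
have sn0 : s != 0 by rewrite -normr_gt0.
have Xu : X (s^-1 *: u) by apply: subspaceZ; exact: OX.
exists (s^-1 *: u); last by rewrite scalerA divff// scale1r.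
exists (SigSub (mem_set Xu)) => //; apply: eU => p Fp /=.
rewrite x0 subr0 (sP p (FP p Fp)).2; last exact: OX.
rewrite normfV mulrC ltr_pdivrMr//.
apply: le_lt_trans (MP p Fp u Ou) _; apply: le_lt_trans (MK p Fp) _.
rewrite mulrC -ltr_pdivrMr//; apply: lt_le_trans Ks; lra.
Qed.

End subspace.

End seminorms.

(** * The uniform boundedness principle *)

Section uniform_boundedness.
Context {R : realType} {E : lmodType R} {X : set E} {N : E -> R}.
Hypotheses (linX : linear_subspace X) (semiN : seminorm_on X N)
  (complete : nested_complete X N).

(** Any [u] with [N u > 0] is rescaled to norm [r], and [f u] is the difference
  of the values of [f] at [u + x] and at the centre [x]. When [N u = 0] no
  rescaling is possible, and [f u = 0] by continuity of [f]. *)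
Lemma bounded_on_ball f x (r C : R) :
  bounded_linear_on X N f -> X x -> 0 < r ->
  (forall y, X y -> N (y - x) <= r -> `|f y| <= C) ->
  forall u, X u -> `|f u| <= 2 * C / r * N u.
Proof.
move=> [[fD fZ] [K fK]] Xx r0 fC u Xu.
have := seminorm_ge0 linX semiN Xu; rewrite le_eqVlt => /orP[/eqP Nu|Nu].
  by apply: le_trans (fK u Xu) _; rewrite -Nu !mulr0.
pose t := r / N u; have t0 : 0 < t by exact: divr_gt0.
have Xtu : X (t *: u) by exact: subspaceZ.
have ftu : `|f (t *: u)| <= 2 * C.
  have Ctx : `|f (t *: u + x)| <= C.
    apply: fC; first exact: subspaceD.
    by rewrite addrK semiN.2// gtr0_norm// divfK// gt_eqF.
  have Cx : `|f x| <= C by apply: fC => //; rewrite subrr (seminorm0 linX)// ltW.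
  rewrite -[f _](addrK (f x)) -fD//; apply: le_trans (ler_normB _ _) _.
  by rewrite mulr_natl mulr2n lerD.
move: ftu; rewrite fZ// normrM gtr0_norm// -ler_pdivlMl//.
by have -> : t^-1 * (2 * C) = 2 * C / r * N u by rewrite /t invf_div; ring.
Qed.

(** [f] is Lipschitz, so it changes by at most half of the margin [`|f y| - C] on
  a small ball around [y]. *)
Lemma large_on_ball f y (r C : R) :
  bounded_linear_on X N f -> X y -> 0 < r -> C < `|f y| ->
  exists s : R, [/\ 0 < s, s <= r &
    forall z, X z -> N (z - y) <= s -> C < `|f z|].
Proof.
move=> [[fD fZ] [K fK]] Xy r0 Cf.
have K1 : 0 < `|K| + 1 by rewrite ltr_wpDl.
pose s := (`|f y| - C) / (`|K| + 1) / 2.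
have s0 : 0 < s by rewrite !divr_gt0// subr_gt0.
exists (Num.min r s); rewrite lt_min r0 s0 ge_min lexx; split => // z Xz.
rewrite le_min => /andP[_ zy].
have Xzy : X (z - y) by exact: subspaceB.
have zyK : `|f (z - y)| <= (`|f y| - C) / 2.
  apply: le_trans (fK _ Xzy) _.
  apply: (@le_trans _ _ ((`|K| + 1) * s)); last first.
    by rewrite /s mulrCA mulrA divfK // gt_eqF.
  apply: (@le_trans _ _ ((`|K| + 1) * N (z - y))); last by rewrite ler_pM2l.
  apply: ler_wpM2r; first exact: (seminorm_ge0 linX).
  by have := ler_norm K; lra.
have := ler_normB (f z) (f (z - y)).
have -> : f z - f (z - y) = f y.
  have -> : f z = f (z - y) + f y by rewrite -fD// subrK.
  by rewrite addrAC subrr add0r.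
move: Cf zyK; lra.
Qed.

(** If [Phi] is not uniformly bounded, then by [bounded_on_ball] it is unbounded
  on every ball, so every ball contains a smaller one on which some member of
  [Phi] exceeds a prescribed value. Iterating yields nested balls, and [Phi] is
  not pointwise bounded at their common point. *)
Lemma uniform_boundedness (Phi : set (E -> R)) :
  (forall f, Phi f -> bounded_linear_on X N f) ->
  (forall u, X u -> exists M : R, forall f, Phi f -> `|f u| <= M) ->
  exists C, forall f u, Phi f -> X u -> `|f u| <= C * N u.
Proof.
move=> blPhi ptPhi; apply: contrapT => unbounded.
have step (n : R) x (r : R) : X x -> 0 < r -> exists y (s : R),
    [/\ X y, 0 < s, s <= r / 2, N (y - x) <= r / 2 &
        exists2 f, Phi f & forall z, X z -> N (z - y) <= s -> n < `|f z|].
  move=> Xx r0; have r20 : 0 < r / 2 by rewrite divr_gt0.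
  have [[f [y [Phif Xy yx fy]]]|small] := pselect (exists f y,
      [/\ Phi f, X y, N (y - x) <= r / 2 & n < `|f y|]).
    have [s [s0 sr fs]] := large_on_ball (blPhi f Phif) Xy r20 fy.
    by exists y, s; split=> //; exists f.
  exfalso; apply: unbounded; exists (2 * n / (r / 2)) => f u Phif Xu.
  apply: (bounded_on_ball (blPhi f Phif) Xx r20) => // y Xy yx.
  by rewrite leNgt; apply/negP => fy; apply: small; exists f, y.
pose ball := [set b : E * R | X b.1 /\ 0 < b.2].
have /choice[next nextP] : forall k : nat * (E * R), exists b : E * R,
    ball k.2 -> [/\ ball b, b.2 <= k.2.2 / 2, N (b.1 - k.2.1) <= k.2.2 / 2 &
    exists2 f, Phi f & forall z, X z -> N (z - b.1) <= b.2 -> k.1%:R < `|f z|].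
  move=> [n [x r]] /=; have [[Xx r0]|nb] := pselect (ball (x, r)); last first.
    by exists (x, r).
  have [y [s [Xy s0 sr yx fP]]] := step n%:R x r Xx r0.
  by exists (y, s).
pose b := fix b n := if n is k.+1 then next (k, b k) else (0, 1).
have bP n : ball (b n).
  elim: n => [|n IH]; first by split; [exact: linX.1|].
  by have [] := nextP (n, b n) IH.
have bS n := nextP (n, b n) (bP n).
have Xb n : X (b n).1 := (bP n).1.
have b2 n : 0 <= (b n).2 := ltW (bP n).2.
(* The radius is added on the left so that the induction on [m] closes: each
   step uses half of the current radius to move the centre and keeps at most
   the other half. *)
have nested m n : (n <= m)%N -> N ((b m).1 - (b n).1) + (b m).2 <= (b n).2.
  move=> /subnKC <-; elim: (m - n)%N => [|k IH].
    by rewrite addn0 subrr (seminorm0 linX)// add0r.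
  apply: le_trans IH; rewrite addnS.
  have [_ + + _] := bS (n + k)%N => /= b2S b1S.
  have Xd i j : X ((b i).1 - (b j).1) by exact: subspaceB.
  have := semiN.1 _ _ (Xd (n + k).+1 (n + k)%N) (Xd (n + k)%N n).
  rewrite addrA subrK; have := b2 (n + k)%N; rewrite /=; lra.
have rgeo n : (b n).2 <= 2^-1 ^+ n.
  elim: n => [|n IH]; first by rewrite expr0.
  have [_ + _ _] := bS n => /= bn; rewrite exprSr; apply: le_trans bn _.
  by rewrite ler_wpM2r.
have r0 : (fun n => (b n).2) @ \oo --> (0 : R).
  have h0 : (fun=> 0) @ \oo --> (0 : R) by exact: cvg_cst.
  have h1 : (fun n => 2^-1 ^+ n) @ \oo --> (0 : R).
    by apply: cvg_expr; rewrite gtr0_norm ?invf_lt1// ltr1n.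
  apply: (squeeze_cvgr _ h0 h1); apply: nearW => n.
  by rewrite b2 rgeo.
have [|y Xy yb] := complete Xb _ r0.
  by move=> m n /nested; have := b2 m; lra.
have [M fM] := ptPhi y Xy.
have [_ _ _ [f Phif fy]] := bS (Num.bound M).
have /= := fy y Xy (yb (Num.bound M).+1); rewrite ltNge => /negP; apply.
have fyM := fM f Phif.
exact: le_trans fyM (ltW (archi_boundP (le_trans (normr_ge0 _) fyM))).
Qed.

End uniform_boundedness.

(** * Unordered sums of real functions *)

Section unordered_sums.
Context {R : realType} {T : choiceType}.
Implicit Types (f h p q : T -> R) (A : set T).

(** [pairing w w'] depends only on the product of [w] and [w'], and its linearity
  in either argument is that of [usum]. *)
Definition usum f : R :=
  fine (\esum_(g in [set: T]) (EFin \o f)^\+ g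
        - \esum_(g in [set: T]) (EFin \o f)^\- g)%E.

Lemma pairingE (w w' : T -> R) : pairing w w' = usum (fun g => w g * w' g).
Proof. by []. Qed.

Lemma esum_leP A f (C : R) :
  (\esum_(g in A) (f g)%:E <= C%:E)%E <->
  forall F : {fset T}, [set` F] `<=` A -> \sum_(g <- F) f g <= C.
Proof.
split=> [fC F FA|fC].
- rewrite -lee_fin -sumEFin; apply: le_trans fC; apply: ereal_sup_ubound.
  by exists [set` F]; [split|rewrite fsbig_finite// set_fsetK].
- apply: ge_ereal_sup => _ [F [finF FA] <-].
  rewrite fsbig_finite// sumEFin lee_fin; apply: fC => g /=.
  by rewrite in_fset_set// inE => /FA.
Qed.

Lemma summableP f :
  summable [set: T] (EFin \o f) <->
  exists C : R, forall F : {fset T}, \sum_(g <- F) `|f g| <= C.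
Proof.
split=> [|[C fC]].
- rewrite summableE => /fineK fs.
  exists (fine (\esum_(g in [set: T]) `|(EFin \o f) g|)%E) => F.
  apply: (esum_leP setT (fun g => `|f g|) _).1 => //.
  by rewrite fs.
- rewrite /summable; apply: (@le_lt_trans _ _ C%:E); last exact: ltry.
  by apply/(esum_leP setT (fun g => `|f g|)) => F _; exact: fC.
Qed.

Lemma summable_le f h :
  summable [set: T] (EFin \o h) -> (forall g, `|f g| <= `|h g|) ->
  summable [set: T] (EFin \o f).
Proof.
move=> sh fh; apply: le_lt_trans sh; apply: le_esum => g _.
by rewrite lee_fin.
Qed.

Lemma summable_lin (a : R) f h :
  summable [set: T] (EFin \o f) -> summable [set: T] (EFin \o h) ->
  summable [set: T] (EFin \o (fun g => a * f g + h g)).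
Proof.
move=> /summableP[C fC] /summableP[D hD]; apply/summableP.
exists (`|a| * C + D) => F.
apply: (@le_trans _ _ (\sum_(g <- F) (`|a| * `|f g| + `|h g|))).
  by apply: ler_sum => g _; rewrite -normrM ler_normD.
by rewrite big_split/= -mulr_sumr lerD// ler_wpM2l.
Qed.

Lemma summableZ (a : R) f :
  summable [set: T] (EFin \o f) ->
  summable [set: T] (EFin \o (fun g => a * f g)).
Proof.
move=> sf; apply: (@summable_le _ (fun g => a * f g + 0)) => [|g].
- apply: summable_lin => //; apply/summableP; exists 0 => F.
  by rewrite big1// => g _; rewrite normr0.
- by rewrite addr0.
Qed.

(** Any decomposition of a function as a difference of nonnegative summable
  functions computes its sum, which is what makes [usum] additive. *)
Lemma usum_sub p q :
  summable [set: T] (EFin \o p) -> summable [set: T] (EFin \o q) ->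
  (forall g, 0 <= p g) -> (forall g, 0 <= q g) ->
  usum (fun g => p g - q g) =
  fine (\esum_(g in [set: T]) (p g)%:E)%E -
  fine (\esum_(g in [set: T]) (q g)%:E)%E.
Proof.
move=> sp sq p0 q0; rewrite /usum.
have := @esumB R T setT (EFin \o p) (EFin \o q) sp sq.
have -> : ((EFin \o p) \- (EFin \o q))%E = EFin \o (fun g => p g - q g) by [].
move=> ->; rewrite ?fineB//.
- by move: sp; rewrite summableE; congr (_ \is a fin_num);
    apply: eq_esum => g _; rewrite /= ger0_norm.
- by move: sq; rewrite summableE; congr (_ \is a fin_num);
    apply: eq_esum => g _; rewrite /= ger0_norm.
- by move=> g _; rewrite lee_fin.
- by move=> g _; rewrite lee_fin.
Qed.

Definition nnsum p : R := fine (\esum_(g in [set: T]) (p g)%:E)%E.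

Lemma nnsumK p : summable [set: T] (EFin \o p) -> (forall g, 0 <= p g) ->
  (\esum_(g in [set: T]) (p g)%:E = (nnsum p)%:E)%E.
Proof.
move=> sp p0; rewrite fineK//; move: sp; rewrite summableE.
by congr (_ \is a fin_num); apply: eq_esum => g _; rewrite /= ger0_norm.
Qed.

Lemma nnsum_leP p (C : R) :
  summable [set: T] (EFin \o p) -> (forall g, 0 <= p g) ->
  nnsum p <= C <-> forall F : {fset T}, \sum_(g <- F) p g <= C.
Proof.
move=> sp p0; rewrite -lee_fin -nnsumK//.
by split=> [/esum_leP pC F|pC]; [exact: pC|apply/esum_leP => F _; exact: pC].
Qed.

Lemma nnsumD p q :
  summable [set: T] (EFin \o p) -> summable [set: T] (EFin \o q) ->
  (forall g, 0 <= p g) -> (forall g, 0 <= q g) ->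
  nnsum (fun g => p g + q g) = nnsum p + nnsum q.
Proof.
move=> sp sq p0 q0; rewrite /nnsum -fineD; last 2 first.
- by rewrite nnsumK.
- by rewrite nnsumK.
by rewrite -esumD// => g _; rewrite lee_fin.
Qed.

Lemma nnsumZ (a : R) p :
  summable [set: T] (EFin \o p) -> (forall g, 0 <= p g) -> 0 <= a ->
  nnsum (fun g => a * p g) = a * nnsum p.
Proof.
move=> sp p0.
have le (b : R) q : summable [set: T] (EFin \o q) -> (forall g, 0 <= q g) ->
    0 <= b -> nnsum (fun g => b * q g) <= b * nnsum q.
  move=> sq q0 b0; apply/nnsum_leP => [|g|F].
  - exact: summableZ.
  - exact: mulr_ge0.
  - by rewrite -mulr_sumr ler_wpM2l//; exact: (nnsum_leP _ _ _).1.
rewrite le_eqVlt => /predU1P[<-|a0].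
  rewrite mul0r /nnsum esum1// => g _; by rewrite mul0r.
apply/eqP; rewrite eq_le le ?(ltW a0)//= -ler_pdivlMl//.
have {1}-> : p = (fun g => a^-1 * (a * p g)).
  by apply/funext => g; rewrite mulKf// gt_eqF.
apply: le => [|g|]; first exact: summableZ.
- by rewrite mulr_ge0// ltW.
- by rewrite invr_ge0 ltW.
Qed.

Definition pospart f : T -> R := fun g => Num.max (f g) 0.
Definition negpart f : T -> R := fun g => Num.max (- f g) 0.

Lemma pospart_ge0 f g : 0 <= pospart f g.
Proof. by rewrite le_max lexx orbT. Qed.

Lemma negpart_ge0 f g : 0 <= negpart f g.
Proof. by rewrite le_max lexx orbT. Qed.

Lemma posnegpartB f g : pospart f g - negpart f g = f g.
Proof.
rewrite /pospart /negpart; have [f0|f0] := leP 0 (f g).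
- by rewrite max_r ?subr0// oppr_le0.
- by rewrite max_l ?sub0r ?opprK ?oppr_ge0// ltW.
Qed.

Lemma posnegpartD f g : pospart f g + negpart f g = `|f g|.
Proof.
rewrite /pospart /negpart; have [f0|f0] := leP 0 (f g).
- by rewrite max_r ?addr0 ?oppr_le0// ger0_norm.
- by rewrite max_l ?add0r ?oppr_ge0 ?ltr0_norm// ltW.
Qed.

Lemma summable_posnegpart f : summable [set: T] (EFin \o f) ->
  summable [set: T] (EFin \o pospart f) /\ summable [set: T] (EFin \o negpart f).
Proof.
move=> sf; split; apply: (summable_le sf) => g; rewrite ger0_norm.
- by rewrite -posnegpartD lerDl negpart_ge0.
- exact: pospart_ge0.
- by rewrite -posnegpartD lerDr pospart_ge0.
- exact: negpart_ge0.
Qed.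

Lemma usumE f : summable [set: T] (EFin \o f) ->
  usum f = nnsum (pospart f) - nnsum (negpart f).
Proof.
move=> /summable_posnegpart[sp sn].
rewrite -usum_sub//; [|exact: pospart_ge0|exact: negpart_ge0].
by congr usum; apply/funext => g; rewrite posnegpartB.
Qed.

Lemma usumD f h :
  summable [set: T] (EFin \o f) -> summable [set: T] (EFin \o h) ->
  usum (fun g => f g + h g) = usum f + usum h.
Proof.
move=> sf sh; rewrite [usum f]usumE// [usum h]usumE//.
have [sfp sfn] := summable_posnegpart sf.
have [shp shn] := summable_posnegpart sh.
rewrite addrACA -opprD -!nnsumD//; try exact: pospart_ge0; try exact: negpart_ge0.
rewrite -usum_sub.
- congr usum; apply/funext => g.
  by rewrite opprD addrACA !posnegpartB.
- rewrite (_ : EFin \o _ =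
    EFin \o (fun g => 1 * pospart f g + pospart h g)); first exact: summable_lin.
  by apply/funext => g /=; rewrite mul1r.
- rewrite (_ : EFin \o _ =
    EFin \o (fun g => 1 * negpart f g + negpart h g)); first exact: summable_lin.
  by apply/funext => g /=; rewrite mul1r.
- by move=> g; rewrite addr_ge0// pospart_ge0.
- by move=> g; rewrite addr_ge0// negpart_ge0.
Qed.

Lemma usumZ (a : R) f : summable [set: T] (EFin \o f) ->
  usum (fun g => a * f g) = a * usum f.
Proof.
move=> sf; rewrite [usum f]usumE//.
have [sp sn] := summable_posnegpart sf.
have [a0|a0] := leP 0 a.
- rewrite mulrBr -!nnsumZ//; [|exact: negpart_ge0|exact: pospart_ge0].
  rewrite -usum_sub; [|exact: summableZ|exact: summableZ|move=> g|move=> g].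
  + by congr usum; apply/funext => g; rewrite -mulrBr posnegpartB.
  + by rewrite mulr_ge0// pospart_ge0.
  + by rewrite mulr_ge0// negpart_ge0.
- have na0 : 0 <= - a by rewrite oppr_ge0 ltW.
  rewrite -mulrNN opprB mulrBr -!nnsumZ//; [|exact: pospart_ge0|exact: negpart_ge0].
  rewrite -usum_sub; [|exact: summableZ|exact: summableZ|move=> g|move=> g].
  + by congr usum; apply/funext => g; rewrite -mulrBr -opprB mulrNN posnegpartB.
  + by rewrite mulr_ge0// negpart_ge0.
  + by rewrite mulr_ge0// pospart_ge0.
Qed.

Lemma normr_usum_le f (C : R) :
  (forall F : {fset T}, \sum_(g <- F) `|f g| <= C) -> `|usum f| <= C.
Proof.
move=> fC; have sf : summable [set: T] (EFin \o f) by apply/summableP; exists C.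
have [sp sn] := summable_posnegpart sf.
have pC : nnsum (pospart f) + nnsum (negpart f) <= C.
  rewrite -nnsumD//; [|exact: pospart_ge0|exact: negpart_ge0].
  have -> : (fun g => pospart f g + negpart f g) = (fun g => `|f g|).
    by apply/funext => g; rewrite posnegpartD.
  apply/nnsum_leP => //; apply: (summable_le sf) => g; by rewrite normr_id.
have p0 : 0 <= nnsum (pospart f).
  by rewrite fine_ge0// esum_ge0// => g _; rewrite lee_fin pospart_ge0.
have n0 : 0 <= nnsum (negpart f).
  by rewrite fine_ge0// esum_ge0// => g _; rewrite lee_fin negpart_ge0.
rewrite usumE// ler_norml; lra.
Qed.

Lemma sum_le_usum p (F : {fset T}) :
  summable [set: T] (EFin \o p) -> (forall g, 0 <= p g) ->
  \sum_(g <- F) p g <= usum p.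
Proof.
move=> sp p0; rewrite (_ : usum p = nnsum p); first exact: (nnsum_leP _ sp p0).1.
rewrite usumE//.
have -> : pospart p = p by apply/funext => g; rewrite /pospart max_l.
rewrite [X in _ - X](_ : _ = 0) ?subr0// /nnsum esum1// => g _.
by rewrite /negpart max_r// oppr_le0.
Qed.

End unordered_sums.

(** * Duality between function spaces *)

Section pairing.
Context {R : realType} {T : choiceType}.
Implicit Types (V Omega : set (T -> R)) (w : T -> R).

Lemma dual_linear V : linear_subspace (dual V).
Proof.
split=> [w Vw|a u v Vu Vv w Vw].
- apply/(summableP (fun g => w g * 0)); exists 0 => F.
  by rewrite big1// => g _; rewrite mulr0 normr0.
- apply: (@summable_le _ _ _ (fun g => a * (w g * u g) + w g * v g)).
  + by apply: summable_lin; [exact: Vu|exact: Vv].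
  + by move=> g; rewrite mulrDr mulrCA.
Qed.

Lemma pairing_linearr V w : V w -> linear_on (dual V) (pairing w).
Proof.
move=> Vw; split=> [u v Vu Vv|a u Vu].
- rewrite !pairingE -usumD; [|exact: Vu|exact: Vv].
  by congr usum; apply/funext => g; rewrite mulrDr.
- rewrite !pairingE -usumZ; last exact: Vu.
  by congr usum; apply/funext => g; rewrite mulrCA.
Qed.

Lemma pairing_linearl V w' :
  dual V w' -> linear_on V (fun w => pairing w w').
Proof.
move=> Vw'; split=> [u v Vu Vv|a u Vu].
- rewrite !pairingE -usumD; [|exact: Vw'|exact: Vw'].
  by congr usum; apply/funext => g; rewrite mulrDl.
- rewrite !pairingE -usumZ; last exact: Vw'.
  by congr usum; apply/funext => g; rewrite -mulrA.
Qed.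

Lemma weakly_boundedP V Omega : weakly_bounded V Omega <->
  Omega `<=` dual V /\ forall w, V w ->
    exists M : R, forall w', Omega w' -> `|pairing w w'| <= M.
Proof.
rewrite /weakly_bounded (tvs_boundedP (dual_linear V)); last first.
  by move=> _ [w Vw <-]; apply: linear_seminorm; exact: pairing_linearr.
split=> -[OV bO]; split=> //.
- by move=> w Vw; apply: (bO (fun w' => `|pairing w w'|)); exists w.
- by move=> _ [w Vw <-]; exact: bO.
Qed.

End pairing.

(** * The normed space of a family of sets *)

Section packing_norm.
Context {R : realType} {T : choiceType} (GG : set (set T)).
Implicit Types (A : set T) (u v w : T -> R) (C : R).

Lemma normS_leP w C : (normS GG w <= C%:E)%E <->
  forall A, GG A -> forall F : {fset T}, [set` F] `<=` A ->
    \sum_(g <- F) `|w g| <= C.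
Proof.
split=> [wC A GA|wC].
- apply/(esum_leP A (fun g => `|w g|)); apply: le_trans wC.
  by apply: ereal_sup_ubound; exists A.
- apply: ge_ereal_sup => _ [A GA <-].
  by apply/(esum_leP A (fun g => `|w g|)); exact: wC.
Qed.

Lemma normS_le_lin (a : R) u v (C D : R) :
  (normS GG u <= C%:E)%E -> (normS GG v <= D%:E)%E ->
  (normS GG (a *: u + v)%R <= (`|a| * C + D)%:E)%E.
Proof.
move=> /normS_leP uC /normS_leP vD; apply/normS_leP => A GA F FA.
apply: (@le_trans _ _ (\sum_(g <- F) (`|a| * `|u g| + `|v g|))).
  by apply: ler_sum => g _; rewrite -normrM ler_normD.
rewrite big_split/= -mulr_sumr lerD ?ler_wpM2l ?(uC A) ?(vD A)//.
Qed.

(** The span contributes the bound [\sum_i `|a i|]. In the other direction the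
  division is by [C + 1], as [C] may be zero. *)
Lemma VSP w : VS GG w <-> exists2 C, 0 <= C & (normS GG w <= C%:E)%E.
Proof.
split=> [[_ [n [a [s [Ss ->]]]] wle]|[C C0 wC]].
- exists (\sum_i `|a i|); first exact: sumr_ge0.
  apply/normS_leP => A GA F FA.
  apply: (@le_trans _ _ (\sum_(g <- F) \sum_i `|a i| * s i g)).
    apply: ler_sum => g _; apply: le_trans (wle g) _.
    rewrite fct_sumE; apply: le_trans (ler_norm_sum _ _ _) _.
    by apply: ler_sum => i _; rewrite /= normrM (ger0_norm ((Ss i).1 g)).
  rewrite exchange_big/=; apply: ler_sum => i _.
  rewrite -mulr_sumr ler_piMr//.
  by apply: (esum_leP A (s i) 1).1 => //; exact: (Ss i).2.
- have C1 : 0 < C + 1 by rewrite ltr_wpDl.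
  pose s g := `|w g| / (C + 1).
  exists ((C + 1) *: s).
    exists 1%N, (fun=> C + 1), (fun=> s); split; last by rewrite big_ord1.
    move=> _; split=> [g|A GA]; first by rewrite divr_ge0// ltW.
    apply/(esum_leP A s) => F FA; rewrite -mulr_suml ler_pdivrMr// mul1r.
    apply: le_trans ((normS_leP _ _).1 wC A GA F FA) _; by rewrite lerDl.
  move=> g; suff -> : ((C + 1) *: s) g = `|w g| by rewrite normr_id.
  by rewrite -[LHS]/((C + 1) * (`|w g| / (C + 1))) mulrC divfK// gt_eqF.
Qed.

(** [normS GG w] is [-oo] when the family is empty; [fine] sends it to zero. *)
Definition packing_norm w : R := fine (normS GG w).
Local Notation N := packing_norm.
Local Notation V := (@VS T R GG).

Lemma packing_norm_le w C : 0 <= C -> (normS GG w <= C%:E)%E -> N w <= C.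
Proof. by rewrite /N; case: (normS GG w). Qed.

Lemma normS_packing_norm w : V w -> (normS GG w <= (N w)%:E)%E.
Proof.
by move=> /VSP[C _]; rewrite /N; case: (normS GG w) => [r| |] //= _;
  rewrite ?lexx ?leNye.
Qed.

Lemma normS_lty w : V w -> (normS GG w < +oo)%E.
Proof. by move=> /normS_packing_norm /le_lt_trans; apply; rewrite ltry. Qed.

Lemma packing_norm_ge0 w : 0 <= N w.
Proof.
have [[A GA]|G0] := pselect (exists A, GG A).
- apply: fine_ge0; apply: (@le_trans _ _ (\esum_(g in A) `|w g|%:E)%E).
    by apply: esum_ge0 => g _; rewrite lee_fin.
  by apply: ereal_sup_ubound; exists A.
- have GG0 : GG = set0.
    by apply/seteqP; split=> // A GA; apply: G0; exists A.
  by rewrite /packing_norm /normS GG0 image_set0 ereal_sup0.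
Qed.

Lemma VS_lin (a : R) u v : V u -> V v ->
  V (a *: u + v) /\ N (a *: u + v) <= `|a| * N u + N v.
Proof.
move=> Vu Vv.
have h := normS_le_lin a (normS_packing_norm Vu) (normS_packing_norm Vv).
have C0 : 0 <= `|a| * N u + N v.
  by rewrite addr_ge0 ?mulr_ge0 ?packing_norm_ge0.
split; last exact: packing_norm_le.
by apply/VSP; exists (`|a| * N u + N v).
Qed.

Lemma VS_linear : linear_subspace V.
Proof.
split=> [|a u v Vu Vv]; last exact: (VS_lin a Vu Vv).1.
by apply/VSP; exists 0 => //; apply/normS_leP => A GA F FA; rewrite big1// => g;
  rewrite normr0.
Qed.

Lemma packing_norm_seminorm : seminorm_on V N.
Proof.
have V0 := VS_linear.1.
have N0 : N 0 = 0.
  apply/eqP; rewrite eq_le packing_norm_ge0 andbT; apply: packing_norm_le => //.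
  by apply/normS_leP => A GA F FA; rewrite big1// => g; rewrite normr0.
have le a u : V u -> N (a *: u) <= `|a| * N u.
  by move=> Vu; have := (VS_lin a Vu V0).2; rewrite N0 !addr0.
split=> [u v Vu Vv|a u Vu].
- by have := (VS_lin 1 Vu Vv).2; rewrite scale1r normr1 mul1r.
- have [->|a0] := eqVneq a 0; first by rewrite scale0r normr0 mul0r.
  apply/eqP; rewrite eq_le le//= -ler_pdivlMl ?normr_gt0//.
  rewrite -normfV -[in leLHS](scalerK a0 u); apply: le.
  exact: (subspaceZ VS_linear).
Qed.

Lemma packing_norm_abs u v :
  (forall g, `|u g| <= `|v g|) -> V v -> V u /\ N u <= N v.
Proof.
move=> uv Vv; have uN : (normS GG u <= (N v)%:E)%E.
  apply/normS_leP => A GA F FA.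
  apply: le_trans ((normS_leP _ _).1 (normS_packing_norm Vv) A GA F FA).
  exact: ler_sum.
split; last by apply: packing_norm_le => //; exact: packing_norm_ge0.
by apply/VSP; exists (N v) => //; exact: packing_norm_ge0.
Qed.

Hypothesis GG_cover : \bigcup_(A in GG) A = [set: T].

Lemma le_packing_norm w g : V w -> `|w g| <= N w.
Proof.
move=> Vw; have [A GA Ag] : (\bigcup_(A in GG) A) g by rewrite GG_cover.
have := (normS_leP _ _).1 (normS_packing_norm Vw) A GA [fset g]%fset.
by rewrite big_seq_fset1; apply => h /=; rewrite inE => /eqP ->.
Qed.

Lemma packing_norm_norm : is_norm_on V N.
Proof.
have [ND NZ] := packing_norm_seminorm; split=> // u Vu Nu.
apply/funext => g; apply/eqP; rewrite -normr_le0 -Nu; exact: le_packing_norm.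
Qed.

(** At each vertex the intervals of centre [x n g] and radius [r n] meet pairwise,
  so the supremum of their left endpoints belongs to all of them; this defines
  the limit. The bound on [y - x n] over a finite set [F] then follows from the
  one on [x m - x n] up to [size F * r m], which vanishes as [m] grows. *)
Lemma VS_complete : nested_complete V N.
Proof.
move=> x r Vx xr r0.
have xrg m n g : (n <= m)%N -> `|x m g - x n g| <= r n.
  move=> nm; apply: le_trans (xr m n nm).
  by apply: (le_packing_norm g); exact: (subspaceB VS_linear).
have rn0 n : 0 <= r n := le_trans (packing_norm_ge0 _) (xr n n (leqnn n)).
have cross m n g : x m g - r m <= x n g + r n.
  have [nm|/ltnW mn] := leqP n m.
  + have := xrg m n g nm; have := rn0 m; rewrite ler_norml; lra.
  + have := xrg n m g mn; have := rn0 n; rewrite ler_norml; lra.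
pose y g := sup (range (fun m => x m g - r m)).
have yx n g : `|y g - x n g| <= r n.
  have ub : ubound (range (fun m => x m g - r m)) (x n g + r n).
    by move=> _ [m _ <-].
  rewrite ler_distl; apply/andP; split; last first.
    by apply: ge_sup => //; exists (x n g - r n); exists n.
  by apply: ub_le_sup; [exists (x n g + r n)|exists n].
have yxN n : (normS GG (y - x n)%R <= (r n)%:E)%E.
  apply/normS_leP => A GA F FA; apply/ler_addgt0Pr => e e0.
  have K0 : 0 < (size F)%:R + 1 :> R by rewrite ltr_wpDl.
  have [m [nm rm]] : exists m, (n <= m)%N /\ r m <= e / ((size F)%:R + 1).
    move/cvgrPdist_le : r0 => /(_ (e / ((size F)%:R + 1))).
    rewrite divr_gt0// => /(_ isT)[k _ rk]; exists (maxn n k).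
    rewrite leq_maxl; split=> //; have := rk (maxn n k) (leq_maxr _ _).
    by rewrite /= sub0r normrN ger0_norm.
  apply: (@le_trans _ _ (\sum_(g <- F) (`|x m g - x n g| + r m))).
    apply: ler_sum => g _; rewrite -[(y - x n) g]/(y g - x n g).
    rewrite -(subrKA (x m g)) addrC; apply: le_trans (ler_normD _ _) _.
    by rewrite lerD.
  rewrite big_split/= lerD//.
    have Vmn : V (x m - x n) by exact: (subspaceB VS_linear).
    apply: le_trans (xr m n nm).
    exact: ((normS_leP _ _).1 (normS_packing_norm Vmn) A GA F FA).
  rewrite big_const_seq count_predT iter_addr_0 -mulr_natr.
  apply: (@le_trans _ _ (e / ((size F)%:R + 1) * ((size F)%:R + 1))).
    by rewrite ler_pM// lerDl.
  by rewrite divfK// gt_eqF.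
have Vyx n : V (y - x n) by apply/VSP; exists (r n).
exists y => [|n]; last exact: packing_norm_le.
by rewrite -(subrK (x 0%N) y); apply: (subspaceD VS_linear).
Qed.

End packing_norm.

(** * Comparison with the strong topology *)

Lemma sup_norm_ge0 {R : realType} {I : Type} (f : I -> R) (A : set I) :
  0 <= sup [set `|f i| | i in A].
Proof.
have [[[x [i Ai fx]] ub]|/sup_out ->//] := pselect (has_sup [set `|f i| | i in A]).
apply: le_trans (normr_ge0 (f i)) _; apply: ub_le_sup => //; by exists i.
Qed.

Section strong_topology.
Context {R : realType} {T : choiceType} (GG : set (set T)).
Hypothesis GG_cover : \bigcup_(A in GG) A = [set: T].
Local Notation N := (@packing_norm R T GG).
Local Notation V := (@VS T R GG).

(** Uniform boundedness applied to the partial sums of the pairing with [w']. The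
  bound obtained is on signed sums; applying it to [`|w| * sg w'], whose norm is
  at most that of [w], turns it into one on sums of absolute values. *)
Lemma dual_pairing_bounded w' : dual V w' ->
  bounded_linear_on V N (fun w => pairing w w').
Proof.
move=> Vw'; split; first exact: pairing_linearl.
pose Phi : set ((T -> R) -> R) :=
  [set (fun w => \sum_(g <- F) w g * w' g) | F in [set: {fset T}]].
have [f [F _ <-]|w Vw|C PhiC] := uniform_boundedness (Phi := Phi)
  (VS_linear GG) (packing_norm_seminorm GG) (VS_complete GG_cover).
- split; first split=> [u v _ _|a u _].
  + by rewrite -big_split/=; apply: eq_bigr => g _; rewrite mulrDl.
  + by rewrite mulr_sumr; apply: eq_bigr => g _; rewrite mulrA.
  + exists (\sum_(g <- F) `|w' g|) => u Vu.
    apply: le_trans (ler_norm_sum _ _ _) _; rewrite mulr_suml.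
    apply: ler_sum => g _; rewrite normrM mulrC ler_wpM2l//.
    exact: le_packing_norm.
- have [C wC] := (summableP _).1 (Vw' w Vw).
  exists C => _ [F _ <-]; exact: le_trans (ler_norm_sum _ _ _) (wC F).
- exists `|C| => w Vw; apply: normr_usum_le => F.
  pose u g := `|w g| * Num.sg (w' g).
  have [Vu uN] : V u /\ N u <= N w.
    apply: packing_norm_abs => // g; rewrite normrM normr_id.
    by rewrite normr_sg ler_piMr// lern1 leq_b1.
  apply: (@le_trans _ _ (C * N u)); last first.
    apply: (@le_trans _ _ (`|C| * N u)); last by rewrite ler_wpM2l.
    by rewrite ler_wpM2r ?packing_norm_ge0// ler_norm.
  apply: le_trans (PhiC (fun w => \sum_(g <- F) w g * w' g) u _ Vu); last by exists F.
  apply: le_trans (ler_norm _); apply: ler_sum => g _.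
  by rewrite normrM /u -mulrA -normrEsg.
Qed.

(** Uniform boundedness applied to a weakly bounded set of functionals, which are
  continuous by [dual_pairing_bounded]. *)
Lemma strong_seminorm_le q :
  strong_seminorms V q -> exists C : R, forall w, V w -> q w <= C * N w.
Proof.
move=> [B /weakly_boundedP[OV bO] <-].
pose Phi : set ((T -> R) -> R) := [set (fun w => pairing w w') | w' in B].
have [f [w' Ow' <-]|w Vw|C PhiC] := uniform_boundedness (Phi := Phi)
  (VS_linear GG) (packing_norm_seminorm GG) (VS_complete GG_cover).
- by apply: dual_pairing_bounded; exact: OV.
- by have [M wM] := bO w Vw; exists M => _ [w' Ow' <-]; exact: wM.
- exists `|C| => w Vw; have [[w0 Ow0]|O0] := pselect (B !=set0); last first.
    rewrite (_ : B = set0) ?image_set0 ?sup0 ?mulr_ge0 ?packing_norm_ge0//.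
    by apply/seteqP; split=> // w' Ow'; apply: O0; exists w'.
  apply: ge_sup => [|_ [w' Ow' <-]]; first by exists `|pairing w w0|, w0.
  apply: le_trans (PhiC (fun w => pairing w w') w _ Vw) _; first by exists w'.
  by rewrite ler_wpM2r ?packing_norm_ge0// ler_norm.
Qed.

Definition indicator_dominated : set (T -> R) :=
  [set w' | exists2 A, GG A & forall g, `|w' g| <= \1_A g].

Lemma indicator_dominated_sum w' w (F : {fset T}) :
  indicator_dominated w' -> V w -> \sum_(g <- F) `|w g * w' g| <= N w.
Proof.
move=> [A GA w'A] Vw.
apply: (@le_trans _ _ (\sum_(g <- F | g \in A) `|w g|)).
  rewrite [leRHS]big_mkcond/=; apply: ler_sum => g _; rewrite normrM.
  have := w'A g; rewrite indicE; case: (g \in A) => /= w'g.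
  - by rewrite ler_piMr.
  - have /eqP -> : w' g == 0 by rewrite -normr_le0.
    by rewrite normr0 mulr0.
rewrite big_fset_condE/=.
apply: ((normS_leP _ _ _).1 (normS_packing_norm Vw) A GA).
by move=> g /=; rewrite !inE => /andP[_]; rewrite inE.
Qed.

Lemma indicator_dominated_weakly_bounded : weakly_bounded V indicator_dominated.
Proof.
apply/weakly_boundedP; split=> [w' Sw' w Vw|w Vw].
- by apply/(summableP (fun g => w g * w' g)); exists (N w) => F;
    exact: indicator_dominated_sum.
- by exists (N w) => w' Sw'; apply: normr_usum_le => F;
    exact: indicator_dominated_sum.
Qed.

(** Pairing with the sign of [w] on a block [A] yields the sum of [`|w|] over [A].
*)
Lemma packing_norm_le_strong w : V w ->
  N w <= sup [set `|pairing w w'| | w' in indicator_dominated].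
Proof.
move=> Vw; have bS :
  has_ubound [set `|pairing w w'| | w' in indicator_dominated].
  exists (N w) => _ [w' Sw' <-]; apply: normr_usum_le => F.
  exact: indicator_dominated_sum.
apply: packing_norm_le; first exact: sup_norm_ge0.
apply/normS_leP => A GA F FA.
pose w' g := Num.sg (w g) * \1_A g.
have Sw' : indicator_dominated w'.
  exists A => // g; rewrite normrM normr_sg indicE normr_nat.
  by rewrite ler_piMl// lern1 leq_b1.
have ww' : forall g, w g * w' g = `|w g| * \1_A g.
  by move=> g; rewrite /w' mulrCA mulrA -normrEsg.
apply: (@le_trans _ _ (pairing w w')); last first.
  by apply: le_trans (ler_norm _) _; apply: ub_le_sup => //; exists w'.
apply: (@le_trans _ _ (\sum_(g <- F) w g * w' g)).
  rewrite le_eqVlt; apply/orP; left; apply/eqP/eq_big_seq => g gF.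
  by rewrite ww' indicE mem_set ?mulr1//; exact: FA.
apply: (sum_le_usum (p := fun g => w g * w' g)).
- exact: ((weakly_boundedP _ _).1 indicator_dominated_weakly_bounded).1.
- by move=> g; rewrite ww' mulr_ge0.
Qed.

End strong_topology.

Unset Implicit Arguments.

Theorem corollary2p11 (R : realType) (T : choiceType) (GG : set (set T))
  (GG_countable : countable GG)
  (GG_sets_countable : forall A, GG A -> countable A)
  (GG_cover : \bigcup_(A in GG) A = [set: T])
  (g1 : cond_g1 GG) (g2 : cond_g2 GG) :
  let V : set (T -> R) := VS GG in
  let N : (T -> R) -> R := fun w => fine (normS GG w) in
  [/\ forall w, V w -> (normS GG w < +oo)%E,
      is_norm_on V N &
      forall U : set (set_type V),
        @open (strong_space V) U <-> @open (seminorm_space V [set N]) U].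
Proof.
move=> V N; split; [exact: normS_lty|exact: packing_norm_norm|].
move=> U; split; apply: (seminorm_open_le (VS_linear GG)).
- move=> q /(strong_seminorm_le GG_cover)[C qC]; exists N => //.
  by exists C.
- by move=> _ u -> _; exact: packing_norm_ge0.
- move=> _ ->.
  exists (fun w => sup [set `|pairing w w'| | w' in indicator_dominated GG]).
    by exists (indicator_dominated GG) => //; exact: indicator_dominated_weakly_bounded.
  by exists 1 => w Vw; rewrite mul1r; exact: packing_norm_le_strong.
- by move=> _ u [B _ <-] _; exact: sup_norm_ge0.
Qed.
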